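(* Let $\mathbb S$ be an elementary extension of $\mathbb M$ and let $X$ be a definable space. Then the following are equivalent: (1) $X$ is definably compact. (2) $X(\mathbb S)$ is $\mathbb S$-definably compact.
   Context: $\mathbb M=(M,<,\ldots)$ is an arbitrary o-minimal structure; ''definable'' means definable in $\mathbb M$, possibly with parameters. A definable space is a set $X=\bigcup_{i\le k}X_i$ with injections (definable charts) $\theta_i:X_i\to M^{n_i}$ ($i\le k$, $k$ finite) such that each $\theta_i(X_i)$ is a definable subset of $M^{n_i}$ (with the induced topology), each $\theta_i(X_i\cap X_j)$ is an open definable subset of $\theta_i(X_i)$, and each transition map $\theta_j\circ\theta_i^{-1}:\theta_i(X_i\cap X_j)\to\theta_j(X_i\cap X_j)$ is a definable homeomorphism. $X$ carries the topology in which each $X_i$ is open and each $\theta_i$ is a homeomorphism. A map $f:X\to Y$ between definable spaces with charts $(X_i,\theta_i)$, $(Y_j,\delta_j)$ is definable if each $\delta_j\circ f\circ\theta_i^{-1}$ (on its natural domain) is a definable map between definable sets. A definable curve in $X$ is a continuous definable map $\alpha:(a,b)\to X$, with $a<b$ in $M\cup\{-\infty,+\infty\}$; it is completable in $X$ if both limits $\lim_{t\to a^+}\alpha(t)$ and $\lim_{t\to b^-}\alpha(t)$ exist in $X$. $X$ is definably compact if every definable curve in $X$ is completable in $X$. For an elementary extension $\mathbb S$ of $\mathbb M$, a definable space $X$ gives rise to an $\mathbb S$-definable space $X(\mathbb S)$ (interpret the formulas defining the charts and transition maps in $\mathbb S$). The prefix ''$\mathbb S$-'' means that the notion is taken in the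 o-minimal structure $\mathbb S$ (parameters from $\mathbb S$ allowed). *)

(* Defs.v *)
From mathcomp Require Import all_boot.
From mathcomp Require Import boolp classical_sets.

Set Implicit Arguments.
Unset Strict Implicit.
Unset Printing Implicit Defensive.

Local Open Scope classical_set_scope.

(** ** First-order structures with an order *)

(* The symbol [<] belongs to every language; [language] lists the others. *)
Record language := Language {
  fsym : Type;
  farity : fsym -> nat;
  rsym : Type;
  rarity : rsym -> nat }.

Inductive term (L : language) : Type :=
| Var of nat
| App (f : fsym L) of ('I_(farity f) -> term L).

(* Variables are de Bruijn indices: [All phi] binds index 0 of [phi].  The
   semantics is classical, so the remaining connectives are definable. *)
Inductive formula (L : language) : Type :=
| Bot
| Eq of term L & term L
| Lt of term L & term L
| Rel (r : rsym L) of ('I_(rarity r) -> term L)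
| Imp of formula L & formula L
| All of formula L.

Record structure (L : language) := Structure {
  carrier :> Type;
  lt : carrier -> carrier -> Prop;
  fint : forall f : fsym L, ('I_(farity f) -> carrier) -> carrier;
  rint : forall r : rsym L, ('I_(rarity r) -> carrier) -> Prop }.

Definition vec (T : Type) (n : nat) := 'I_n -> T.

Definition scons (T : Type) (x : T) (e : nat -> T) : nat -> T :=
  fun k => if k is k'.+1 then e k' else x.

Definition env (T : Type) (n : nat) (x : vec T n) (e : nat -> T) : nat -> T :=
  fun k => if insub k is Some i then x i else e (k - n).

Definition vcat (T : Type) (m n : nat) (x : vec T m) (y : vec T n) :
    vec T (m + n) :=
  fun k => match split k with inl i => x i | inr i => y i end.

Section Semantics.
Variables (L : language) (M : structure L).

Fixpoint eval (e : nat -> M) (t : term L) : M :=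
  match t with
  | Var k => e k
  | App f a => fint (fun i => eval e (a i))
  end.

Fixpoint sat (e : nat -> M) (phi : formula L) : Prop :=
  match phi with
  | Bot => False
  | Eq s t => eval e s = eval e t
  | Lt s t => lt (eval e s) (eval e t)
  | Rel r a => rint (fun i => eval e (a i))
  | Imp phi1 phi2 => sat e phi1 -> sat e phi2
  | All phi1 => forall x : M, sat (scons x e) phi1
  end.

(* [phi] with parameters [e] defines [A]: indices below [n] stand for the
   coordinates, index [n + k] for the parameter [e k] (only finitely many of
   these occur in [phi]). *)
Definition defines (n : nat) (phi : formula L) (e : nat -> M)
    (A : set (vec M n)) : Prop :=
  forall x, A x <-> sat (env x e) phi.

Definition definable (n : nat) (A : set (vec M n)) : Prop :=
  exists phi e, defines phi e A.

Definition joint (m n : nat) (R : vec M m -> vec M n -> Prop) :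
    set (vec M (m + n)) :=
  [set z | R (fun i => z (lshift n i)) (fun i => z (rshift m i))].

Definition definable_rel (m n : nat) (R : vec M m -> vec M n -> Prop) : Prop :=
  definable (joint R).

(** ** Intervals, o-minimality and the topology of [M^n] *)

(* The set [M] together with [-oo] and [+oo]. *)
Variant endpoint : Type := NInfty | Fin of M | PInfty.

Definition elt (a b : endpoint) : Prop :=
  match a, b with
  | Fin x, Fin y => lt x y
  | PInfty, _ | _, NInfty => False
  | NInfty, _ | _, PInfty => True
  end.

Definition interval (a b : endpoint) : set M :=
  [set t | elt a (Fin t) /\ elt (Fin t) b].

Definition point_or_interval (A : set M) : Prop :=
  (exists x, A = [set x]) \/ (exists a b, A = interval a b).

Record o_minimal : Prop := OMinimal {
  omin_inhabited : inhabited M;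
  omin_irr : forall x : M, ~ lt x x;
  omin_trans : forall x y z : M, lt x y -> lt y z -> lt x z;
  omin_total : forall x y : M, [\/ lt x y, x = y | lt y x];
  omin_dense : forall x y : M, lt x y -> exists z : M, lt x z /\ lt z y;
  omin_nomin : forall x : M, exists y : M, lt y x;
  omin_nomax : forall x : M, exists y : M, lt x y;
  omin_tame : forall A : set M,
    definable [set x : vec M 1 | A (x ord0)] ->
    exists (k : nat) (P : 'I_k -> set M),
      (forall i, point_or_interval (P i)) /\ A = \bigcup_i P i }.

Definition box (n : nat) (a b : 'I_n -> endpoint) : set (vec M n) :=
  [set x | forall i, interval (a i) (b i) (x i)].

Definition vopen (n : nat) (V : set (vec M n)) : Prop :=
  forall x, V x -> exists a b, box a b x /\ box a b `<=` V.

Definition open_in (n : nat) (D W : set (vec M n)) : Prop :=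
  exists V, vopen V /\ W = D `&` V.

(* [R] is the graph of a homeomorphism from [D] onto [E], for the topologies
   induced from the ambient powers of [M]. *)
Record homeomorphism (m n : nat) (D : set (vec M m)) (E : set (vec M n))
    (R : vec M m -> vec M n -> Prop) : Prop := Homeomorphism {
  homeo_sub : forall x y, R x y -> D x /\ E y;
  homeo_fun : forall x, D x -> exists! y, R x y;
  homeo_inv : forall y, E y -> exists! x, R x y;
  homeo_cont : forall W, open_in E W ->
    open_in D [set x | exists y, W y /\ R x y];
  homeo_inv_cont : forall W, open_in D W ->
    open_in E [set y | exists x, W x /\ R x y] }.

(** ** Definable spaces *)

(* A set with finitely many [M]-valued charts, [chart i] having domain
   [dom i]; the axioms are in [definable_space] below. *)
Record space := Space {
  point :> Type;
  nchart : nat;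
  dim : 'I_nchart -> nat;
  dom : 'I_nchart -> set point;
  chart : forall i, {p : point | dom i p} -> vec M (dim i) }.

Definition chart_image (X : space) (i : 'I_(nchart X)) (A : set X) :
    set (vec M (dim i)) :=
  [set x | exists u : {p | dom i p}, A (proj1_sig u) /\ chart u = x].
Arguments chart_image {X} i A.

Definition transition (X : space) (i j : 'I_(nchart X)) (x : vec M (dim i))
    (y : vec M (dim j)) : Prop :=
  exists (u : {p | dom i p}) (v : {p | dom j p}),
    [/\ proj1_sig u = proj1_sig v, chart u = x & chart v = y].

Record definable_space (X : space) : Prop := DefinableSpace {
  ds_cover : forall p : X, exists i, dom i p;
  ds_inj : forall i : 'I_(nchart X), injective (@chart X i);
  ds_image : forall i : 'I_(nchart X), definable (chart_image i (dom i));
  ds_overlap_def : forall i j : 'I_(nchart X),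
    definable (chart_image i (dom i `&` dom j));
  ds_overlap_open : forall i j : 'I_(nchart X),
    open_in (chart_image i (dom i)) (chart_image i (dom i `&` dom j));
  ds_trans_def : forall i j : 'I_(nchart X),
    definable_rel (@transition X i j);
  ds_trans_homeo : forall i j : 'I_(nchart X),
    homeomorphism (chart_image i (dom i `&` dom j))
      (chart_image j (dom i `&` dom j)) (@transition X i j) }.

(* The topology for which every [dom i] is open and every [chart i] is a
   homeomorphism onto its image. *)
Definition sopen (X : space) (A : set X) : Prop :=
  forall i : 'I_(nchart X),
    open_in (chart_image i (dom i)) (chart_image i (dom i `&` A)).

Definition scontinuous (X Y : space) (f : X -> Y) : Prop :=
  forall B : set Y, sopen B -> sopen (f @^-1` B).

(* The graph of [f] read in the charts [i] and [j]. *)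
Definition chart_graph (X Y : space) (f : X -> Y) (i : 'I_(nchart X))
    (j : 'I_(nchart Y)) (x : vec M (dim i)) (y : vec M (dim j)) : Prop :=
  exists (u : {p | dom i p}) (v : {q | dom j q}),
    [/\ f (proj1_sig u) = proj1_sig v, chart u = x & chart v = y].

Definition definable_map (X Y : space) (f : X -> Y) : Prop :=
  forall (i : 'I_(nchart X)) (j : 'I_(nchart Y)),
    definable (chart_image i (dom i `&` f @^-1` dom j)) /\
    definable_rel (@chart_graph X Y f i j).

(** ** Definable compactness *)

Definition interval_space (a b : endpoint) : space :=
  @Space {t : M | interval a b t} 1 (fun=> 1) (fun=> setT)
    (fun _ u _ => proj1_sig (proj1_sig u)).

Definition lim_left_end (X : space) (a b : endpoint)
    (alpha : interval_space a b -> X) (p : X) : Prop :=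
  forall A : set X, sopen A -> A p ->
    exists c : M, elt a (Fin c) /\
      forall t : interval_space a b, lt (proj1_sig t) c -> A (alpha t).

Definition lim_right_end (X : space) (a b : endpoint)
    (alpha : interval_space a b -> X) (p : X) : Prop :=
  forall A : set X, sopen A -> A p ->
    exists c : M, elt (Fin c) b /\
      forall t : interval_space a b, lt c (proj1_sig t) -> A (alpha t).

Definition completable (X : space) (a b : endpoint)
    (alpha : interval_space a b -> X) : Prop :=
  (exists p, lim_left_end alpha p) /\ (exists p, lim_right_end alpha p).

Definition definably_compact (X : space) : Prop :=
  forall (a b : endpoint) (alpha : interval_space a b -> X),
    elt a b -> definable_map alpha -> scontinuous alpha -> completable alpha.

End Semantics.

Arguments chart_image {L M X} i A.

(** ** Elementary extensions and extension of definable spaces *)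

(* An elementary extension of [M] is presented by an elementary embedding. *)
Definition elementary (L : language) (M S : structure L) (h : M -> S) : Prop :=
  forall (phi : formula L) (e : nat -> M), sat e phi <-> sat (h \o e) phi.

Section Extension.
Variables (L : language) (M S : structure L) (h : M -> S).

(* [A(S)] for a definable set [A]: the interpretation in [S] of a formula
   defining [A] in [M].  When [h] is elementary it does not depend on the
   formula, so that any one of them may be used. *)
Definition extset (n : nat) (A : set (vec M n)) : set (vec S n) :=
  [set y | exists phi e, defines phi e A /\ sat (env y (h \o e)) phi].

Definition extrel (m n : nat) (R : vec M m -> vec M n -> Prop)
    (x : vec S m) (y : vec S n) : Prop :=
  extset (joint R) (vcat x y).

(* [X(S)] is obtained by gluing the sets [(chart_image i (dom i))(S)] along
   the extended transition maps: a point is a class of pairs [(i, x)] with [x]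
   in the [i]-th set, and its [i]-th chart picks the representative over [i]. *)
Variable X : space M.

Definition rep := {i : 'I_(nchart X) & vec S (dim i)}.

Definition glued (p q : rep) : Prop :=
  extrel (@transition L M X (tag p) (tag q)) (tagged p) (tagged q).

Definition glue_class (c : set rep) : Prop :=
  exists p : rep,
    extset (chart_image (tag p) (dom (tag p))) (tagged p) /\ c = glued p.

Definition ext_dom (i : 'I_(nchart X)) : set {c | glue_class c} :=
  [set c | exists x : vec S (dim i), proj1_sig c (existT _ i x)].

Definition ext_chart (i : 'I_(nchart X)) (u : {c | ext_dom i c}) :
    vec S (dim i) :=
  proj1_sig (cid (proj2_sig u)).

Definition ext_space : space S :=
  @Space L S {c | glue_class c} (nchart X) (@dim L M X) ext_dom ext_chart.

End Extension.

(* Main.v *)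
From mathcomp Require Import all_boot.
From mathcomp Require Import boolp classical_sets.
Require Import Defs.

(** A definable space [X] is determined by the definable sets [D i] that are
    the images of its charts and by the definable transition relations [R i j].
    Everything about it that can be said with these sets and with boxes is
    first-order, hence passes between [M] and an elementary extension [S].

    For a fixed tuple of formulas [phi], one for each chart, the following is
    first-order: for all parameters [c] and all endpoints [a], [b], if the
    formulas [phi] with parameters [c] define the chart graphs of a continuous
    curve on [(a, b)], then this curve has a limit at both ends
    ([compactness_instance]).  Limits and continuity can be tested with boxes
    in charts, because the sets of points that a chart sends into a box form a
    basis of the topology ([sopen_chart_nbhd], [sopen_contains_box]).  Since
    the formulas have finitely many variables, the quantifier over all
    parameters is a first-order one ([first_order_forall_fun]).

    A space is definably compact if and only if these conditions hold for all
    [phi] ([definably_compactP]): definable compactness is a scheme of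
    first-order sentences with parameters for the charts.  The parameters of
    curves being quantified inside each sentence, a sentence holds for [X] in
    [M] if and only if it holds in [S] for the sets [D i](S) and the relations
    [R i j](S).  These are the chart images and transitions of the extended
    space ([chart_image_ext], [transition_ext]), because the relations
    [R i j](S) inherit from [M] the property of gluing the sets [D i](S)
    ([first_order_gluing]). *)

Set Implicit Arguments.
Unset Strict Implicit.
Unset Printing Implicit Defensive.

Local Open Scope classical_set_scope.

(** * Renaming the variables of a formula *)

Section Renaming.
Variable L : language.

Fixpoint rename_term (r : nat -> nat) (t : term L) : term L :=
  match t with
  | Var k => Var L (r k)
  | App f a => App (fun i => rename_term r (a i))
  end.

Definition lift_renaming (r : nat -> nat) : nat -> nat :=
  fun k => if k is k'.+1 then (r k').+1 else 0.

Fixpoint rename (r : nat -> nat) (phi : formula L) : formula L :=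
  match phi with
  | Bot => Bot L
  | Eq s t => Eq (rename_term r s) (rename_term r t)
  | Lt s t => Lt (rename_term r s) (rename_term r t)
  | Rel R a => Rel (fun i => rename_term r (a i))
  | Imp phi1 phi2 => Imp (rename r phi1) (rename r phi2)
  | All phi1 => All (rename (lift_renaming r) phi1)
  end.

Variable T : structure L.

Lemma eval_rename r (e : nat -> T) t :
  eval e (rename_term r t) = eval (fun k => e (r k)) t.
Proof. by elim: t => [//|f a IH] /=; congr fint; apply: funext => i. Qed.

Lemma sat_rename phi : forall r (e : nat -> T),
  sat e (rename r phi) <-> sat (fun k => e (r k)) phi.
Proof.
elim: phi => [|s t|s t|R a|phi1 IH1 phi2 IH2|phi IH] r e /=.
- by [].
- by rewrite !eval_rename.
- by rewrite !eval_rename.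
- by under eq_fun do rewrite eval_rename.
- by rewrite IH1 IH2.
- have E x : (fun k => scons x e (lift_renaming r k)) =
      scons x (fun k => e (r k)) by apply: funext => -[].
  by split=> H x; have := H x; rewrite IH E.
Qed.

Lemma eval_bound (t : term L) : exists N, forall (U : structure L)
    (e e' : nat -> U), (forall k, k < N -> e k = e' k) -> eval e t = eval e' t.
Proof.
elim: t => [k|f a IH]; first by exists k.+1 => U e e' H; apply: H.
have /choice[N HN] := IH; exists (\max_i N i) => U e e' H /=.
congr fint; apply: funext => i; apply: HN => k Hk; apply: H.
exact: leq_trans Hk (leq_bigmax i).
Qed.

(** A formula has finitely many free variables; this is what makes
    quantification over infinitely many parameters first-order below. *)
Lemma sat_bound (phi : formula L) : exists N, forall (U : structure L)
    (e e' : nat -> U), (forall k, k < N -> e k = e' k) ->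
    (sat e phi <-> sat e' phi).
Proof.
elim: phi => [|s t|s t|R a|phi1 [N1 H1] phi2 [N2 H2]|phi [N HN]].
- by exists 0.
- have [[N1 H1] [N2 H2]] := (eval_bound s, eval_bound t).
  exists (maxn N1 N2) => U e e' H /=; rewrite (H1 U e e') ?(H2 U e e') //.
    by move=> k Hk; apply: H; rewrite leq_max Hk orbT.
  by move=> k Hk; apply: H; rewrite leq_max Hk.
- have [[N1 H1] [N2 H2]] := (eval_bound s, eval_bound t).
  exists (maxn N1 N2) => U e e' H /=; rewrite (H1 U e e') ?(H2 U e e') //.
    by move=> k Hk; apply: H; rewrite leq_max Hk orbT.
  by move=> k Hk; apply: H; rewrite leq_max Hk.
- have /choice[N HN] := fun i => eval_bound (a i).
  exists (\max_i N i) => U e e' H /=.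
  suff -> : (fun i => eval e (a i)) = (fun i => eval e' (a i)) by [].
  apply: funext => i; apply: HN => k Hk; apply: H.
  exact: leq_trans Hk (leq_bigmax i).
- exists (maxn N1 N2) => U e e' H /=; rewrite (H1 U e e') ?(H2 U e e') //.
    by move=> k Hk; apply: H; rewrite leq_max Hk orbT.
  by move=> k Hk; apply: H; rewrite leq_max Hk.
- exists N => U e e' H /=.
  have E x : sat (scons x e) phi <-> sat (scons x e') phi.
    by apply: HN => -[//|k] Hk /=; apply: H; apply: ltnW.
  by split=> K x; apply/E.
Qed.

Lemma sat_iter_All N (phi : formula L) : forall e : nat -> T,
  sat e (iter N (@All L) phi) <->
  forall x : nat -> T, sat (fun k => if k < N then x k else e (k - N)) phi.
Proof.
elim: N phi => [|N IH] phi e.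
  have E x : (fun k => if k < 0 then x k else e (k - 0)) = e.
    by apply: funext => k; rewrite subn0.
  by split=> [H x|/(_ e)]; rewrite E.
rewrite iterSr IH; split=> H x.
  have := H (fun k => x k.+1) (x 0).
  by congr sat; apply: funext => -[|k] //=.
move=> y; have := H (scons y x).
by congr sat; apply: funext => -[|k] //=.
Qed.

End Renaming.

(** * Uniformly first-order properties *)

Section FirstOrder.
Variable L : language.

(** A property of valuations [V -> T], given for all structures [T] at once, is
    first-order when one formula expresses it in every [T].  Arbitrary index
    types [V] avoid de Bruijn arithmetic: quantifying over a tuple indexed by
    [I] turns [V] into [V + I].  The guard [V ->] stands for non-emptiness of
    [V], which is needed to have any valuation of the de Bruijn indices. *)
Definition first_order (V : Type)
    (P : forall T : structure L, (V -> T) -> Prop) : Prop :=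
  V -> exists (phi : formula L) (r : nat -> V),
    forall (T : structure L) (e : V -> T), P T e <-> sat (fun k => e (r k)) phi.

Lemma first_order_transfer (M S : structure L) (h : M -> S) V P :
  elementary h -> V -> @first_order V P ->
  forall e : V -> M, P M e <-> P S (fun v => h (e v)).
Proof. by move=> h_elem v0 /(_ v0)[phi [r H]] e; rewrite !H; apply: h_elem. Qed.

Section Closure.
Variable V : Type.
Implicit Types P Q : forall T : structure L, (V -> T) -> Prop.

Lemma first_order_iff P Q :
  (forall T e, P T e <-> Q T e) -> first_order P -> first_order Q.
Proof.
move=> E H v0; have [phi [r K]] := H v0.
by exists phi, r => T e; rewrite -E.
Qed.

Lemma first_order_False : first_order (fun T (_ : V -> T) => False).
Proof. by move=> v0; exists (Bot L), (fun=> v0). Qed.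

Lemma first_order_eq u v : first_order (fun T (e : V -> T) => e u = e v).
Proof.
move=> _; exists (Eq (Var L 0) (Var L 1)).
by exists (fun k => if k is 0 then u else v).
Qed.

Lemma first_order_lt u v : first_order (fun T (e : V -> T) => lt (e u) (e v)).
Proof.
move=> _; exists (Lt (Var L 0) (Var L 1)).
by exists (fun k => if k is 0 then u else v).
Qed.

Lemma first_order_imp P Q :
  first_order P -> first_order Q -> first_order (fun T e => P T e -> Q T e).
Proof.
move=> HP HQ v0; have [[phi [r HP']] [psi [s HQ']]] := (HP v0, HQ v0).
(* The two formulas get disjoint variables: odd indices for the premise. *)
exists (Imp (rename (fun k => k.*2.+1) phi) (rename double psi)).
exists (fun k => if odd k then r k./2 else s k./2) => T e /=.
rewrite !sat_rename HP' HQ'.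
under [X in _ <-> (sat X phi -> _)]eq_fun do
  rewrite /= odd_double /= uphalf_double.
by under [X in _ <-> (_ -> sat X psi)]eq_fun do rewrite odd_double doubleK.
Qed.

Lemma first_order_True : first_order (fun T (_ : V -> T) => True).
Proof.
by apply: first_order_iff (first_order_imp first_order_False first_order_False).
Qed.

Lemma first_order_not P : first_order P -> first_order (fun T e => ~ P T e).
Proof. by move=> HP; apply: first_order_imp HP first_order_False. Qed.

Lemma first_order_and P Q :
  first_order P -> first_order Q -> first_order (fun T e => P T e /\ Q T e).
Proof.
move=> HP HQ; have := first_order_not (first_order_imp HP (first_order_not HQ)).
apply: first_order_iff => T e; split=> [H|[p q] /(_ p)//].
by split; apply: contrapT => N; apply: H.
Qed.

Lemma first_order_equiv P Q :
  first_order P -> first_order Q -> first_order (fun T e => P T e <-> Q T e).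
Proof. by move=> HP HQ; apply: first_order_and; apply: first_order_imp. Qed.

(** Only the finitely many coordinates of [c] that occur in the formula
    expressing [P] have to be quantified, whatever the index type [I] is.  The
    infinite sequences of parameters allowed in definable sets can thus be
    quantified over by a formula. *)
Lemma first_order_forall_fun (I : eqType)
    (P : forall T : structure L, (V -> T) -> (I -> T) -> Prop) :
  first_order (fun T (e : V + I -> T) =>
    P T (fun v => e (inl v)) (fun i => e (inr i))) ->
  first_order (fun T (e : V -> T) => forall c : I -> T, P T e c).
Proof.
move=> HP v0; have [phi [r H]] := HP (inl v0); have [N HN] := sat_bound phi.
pose coord k := if r k is inr i then Some i else None.
pose s := [seq coord k | k <- iota 0 N].
(* Variables standing for one coordinate [i] share a quantifier, found at the
   first place where [i] occurs. *)
exists (iter N (@All L) (rename (fun k =>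
  if r k is inr i then index (Some i) s else N + k) phi)).
exists (fun k => if r k is inl v then v else v0) => T e.
have s_mem k i : k < N -> r k = inr i -> Some i \in s.
  by move=> ltkN rk; apply/mapP; exists k; rewrite ?mem_iota // /coord rk.
have s_index k i : k < N -> r k = inr i -> index (Some i) s < N.
  move=> ltkN rk; have := s_mem _ _ ltkN rk.
  by rewrite -index_mem size_map size_iota.
have E c : P T e c <-> sat (fun k => match r k with
    inl v => e v | inr i => c i end) phi.
  exact: H T (fun z => match z with inl v => e v | inr i => c i end).
rewrite sat_iter_All; split=> [K x | K c].
  rewrite sat_rename; have := (E (fun i => x (index (Some i) s))).1 (K _).
  apply: (proj1 (HN T _ _ _)) => k ltkN; case rk: (r k) => [v|i].
    by rewrite ltnNge leq_addr addKn rk.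
  by rewrite (s_index k).
have := K (fun k => if nth None s k is Some i then c i else e v0).
rewrite sat_rename E; apply: (proj1 (HN T _ _ _)) => k ltkN.
case rk: (r k) => [v|i].
  by rewrite ltnNge leq_addr addKn rk.
by rewrite (s_index k) // nth_index // (s_mem k).
Qed.

Lemma first_order_forall (P : forall T : structure L, (V -> T) -> T -> Prop) :
  first_order (fun T (e : V + unit -> T) =>
    P T (fun v => e (inl v)) (e (inr tt))) ->
  first_order (fun T (e : V -> T) => forall x : T, P T e x).
Proof.
move=> H; have := @first_order_forall_fun unit (fun T e c => P T e (c tt)) H.
by apply: first_order_iff => T e; split=> K x; [apply: K (fun=> x)|].
Qed.

End Closure.

Section Derived.
Variable V : Type.
Implicit Types P Q : forall T : structure L, (V -> T) -> Prop.

Lemma first_order_exists_fun (I : eqType)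
    (P : forall T : structure L, (V -> T) -> (I -> T) -> Prop) :
  first_order (fun T (e : V + I -> T) =>
    P T (fun v => e (inl v)) (fun i => e (inr i))) ->
  first_order (fun T (e : V -> T) => exists c : I -> T, P T e c).
Proof.
move=> /first_order_not H.
have := first_order_not
  (@first_order_forall_fun V I (fun T e c => ~ P T e c) H).
apply: first_order_iff => T e; split=> [/existsNP[c /contrapT]|[c Pc] /(_ c)//].
by exists c.
Qed.

Lemma first_order_exists (P : forall T : structure L, (V -> T) -> T -> Prop) :
  first_order (fun T (e : V + unit -> T) =>
    P T (fun v => e (inl v)) (e (inr tt))) ->
  first_order (fun T (e : V -> T) => exists x : T, P T e x).
Proof.
move=> H; have := @first_order_exists_fun unit (fun T e c => P T e (c tt)) H.
apply: first_order_iff => T e.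
by split=> [[c]|[x]]; [exists (c tt)|exists (fun=> x)].
Qed.

Lemma first_order_forall_ord n
    (P : 'I_n -> forall T : structure L, (V -> T) -> Prop) :
  (forall i, first_order (P i)) ->
  first_order (fun T (e : V -> T) => forall i, P i T e).
Proof.
elim: n P => [|n IH] P HP.
  by apply: first_order_iff (@first_order_True V) => T e; split=> // _ [].
have := first_order_and (HP ord0) (IH _ (fun i => HP (lift ord0 i))).
apply: first_order_iff => T e; split=> [[H0 H] i|H]; last by split.
by case: (unliftP ord0 i) => [j|] ->.
Qed.

Lemma first_order_exists_ord n
    (P : 'I_n -> forall T : structure L, (V -> T) -> Prop) :
  (forall i, first_order (P i)) ->
  first_order (fun T (e : V -> T) => exists i, P i T e).
Proof.
move=> HP.
have := first_order_not
  (first_order_forall_ord (fun i => first_order_not (HP i))).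
apply: first_order_iff => T e; split=> [/existsNP[i /contrapT]|[i Pi] /(_ i)//].
by exists i.
Qed.

Lemma first_order_forall_endpoint
    (P : forall T : structure L, (V -> T) -> endpoint T -> Prop) :
  first_order (fun T e => P T e (@NInfty L T)) ->
  first_order (fun T (e : V + unit -> T) =>
    P T (fun v => e (inl v)) (Fin (e (inr tt)))) ->
  first_order (fun T e => P T e (@PInfty L T)) ->
  first_order (fun T (e : V -> T) => forall a : endpoint T, P T e a).
Proof.
move=> HN HF HP.
have HF' := @first_order_forall V (fun T e x => P T e (Fin x)) HF.
have := first_order_and HN (first_order_and HF' HP).
by apply: first_order_iff => T e; split=> [[? [? ?]] []|H].
Qed.

Lemma first_order_vec_eq n (f g : 'I_n -> V) :
  first_order (fun T (e : V -> T) => (fun i => e (f i)) = (fun i => e (g i))).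
Proof.
have := first_order_forall_ord (fun i => first_order_eq (f i) (g i)).
apply: first_order_iff => T e; split=> [H|H i]; first exact: funext.
exact: (congr1 (fun x => x i) H).
Qed.

Lemma first_order_sat phi n (f : 'I_n -> V) (g : nat -> V) :
  first_order (fun T (e : V -> T) =>
    sat (env (fun i => e (f i)) (fun k => e (g k))) phi).
Proof.
move=> _; exists phi, (env f g) => T e.
suff -> : env (fun i => e (f i)) (fun k => e (g k)) = fun k => e (env f g k).
  by [].
by apply: funext => k; rewrite /env; case: insub.
Qed.

Lemma first_order_sat_vcat phi m n (f : 'I_m -> V) (f' : 'I_n -> V)
    (g : nat -> V) :
  first_order (fun T (e : V -> T) =>
    sat (env (vcat (fun i => e (f i)) (fun i => e (f' i)))
      (fun k => e (g k))) phi).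
Proof.
apply: first_order_iff (first_order_sat phi (vcat f f') g) => T e.
suff -> : vcat (fun i => e (f i)) (fun i => e (f' i)) =
    fun i => e (vcat f f' i) by [].
by apply: funext => k; rewrite /vcat; case: split.
Qed.

End Derived.

(** Fixing the parameters [c] turns a first-order property into a definable
    set: coordinates get the indices below [n], as [defines] requires. *)
Lemma first_order_definable (T : structure L) n
    (P : forall T : structure L, (nat + 'I_n -> T) -> Prop) (c : nat -> T) :
  first_order P ->
  definable [set x : vec T n |
    P T (fun v => match v with inl k => c k | inr i => x i end)].
Proof.
move=> HP; have [phi [r H]] := HP (inl 0).
pose index_of k := match r k with inl j => n + j | inr i => nat_of_ord i end.
exists (rename index_of phi), c => x /=; rewrite H sat_rename.
suff -> : (fun k => match r k with inl j => c j | inr i => x i end) =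
    (fun k => env x c (index_of k)) by [].
apply: funext => k; rewrite /env /index_of; case: (r k) => [j|i].
  by rewrite insubF ?addKn // ltnNge leq_addr.
by rewrite valK.
Qed.

End FirstOrder.

(** * Gluing data and curves, read in charts *)

Section Charts.
Variables (L : language) (T : structure L).

Definition inbox n (lo hi x : vec T n) : Prop :=
  forall i, lt (lo i) (x i) /\ lt (x i) (hi i).

Variables (k : nat) (dim : 'I_k -> nat).
Variable D : forall i, set (vec T (dim i)).
Variable R : forall i j, vec T (dim i) -> vec T (dim j) -> Prop.

(** What makes a family of relations [R] on the sets [D i] the identification
    of points that agree in the glued space: an equivalence relation on the
    disjoint union, trivial on each [D i]. *)
Definition gluing_equivalence : Prop :=
  (forall i j x y, @R i j x y -> D x /\ D y) /\
  (forall i x, D x -> @R i i x x) /\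
  (forall i (x y : vec T (dim i)), R x y -> x = y) /\
  (forall i j x y, @R i j x y -> @R j i y x) /\
  (forall i j l x y z, @R i j x y -> @R j l y z -> @R i l x z).

(** Openness of the chart overlaps and continuity of the transition maps in
    one condition: on some neighbourhood of [x] in the whole of [D i] the
    transition to [j] is defined, with values in a given box around [y].  Only
    boxes are mentioned, so that this is first-order. *)
Definition gluing_open : Prop :=
  forall i j x y, @R i j x y -> forall lo hi, inbox lo hi y ->
    exists lo' hi', inbox lo' hi' x /\
      forall x', D x' -> inbox lo' hi' x' ->
        exists y', inbox lo hi y' /\ @R i j x' y'.

Variables (a b : endpoint T) (G : forall j, T -> vec T (dim j) -> Prop).

(** [G j] is to be the graph of a curve on [(a, b)] read in chart [j]. *)
Definition curve_in_charts : Prop :=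
  (forall j t x, @G j t x -> (elt a (Fin t) /\ elt (Fin t) b) /\ D x) /\
  (forall t, elt a (Fin t) -> elt (Fin t) b -> exists j x, @G j t x) /\
  (forall j l t x y, @G j t x -> (@G l t y <-> @R j l x y)) /\
  (forall j t x, @G j t x -> forall lo hi, inbox lo hi x ->
    exists c d, (lt c t /\ lt t d) /\ forall s,
      elt a (Fin s) -> elt (Fin s) b -> lt c s -> lt s d ->
      exists x', inbox lo hi x' /\ @G j s x').

(** Limits at the two ends of the interval differ only in what a tail of the
    interval is: [cut c] says that [c] may bound a tail, [tail c t] that [t]
    lies in the tail bounded by [c]. *)
Definition limit_in_charts (cut : T -> Prop) (tail : T -> T -> Prop) : Prop :=
  exists i (x : vec T (dim i)), D x /\ forall lo hi, inbox lo hi x ->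
    exists c, cut c /\ forall t,
      elt a (Fin t) -> elt (Fin t) b -> tail c t ->
      exists x', inbox lo hi x' /\ G t x'.

End Charts.

(** The part of definable compactness that concerns the curves whose chart
    graphs are given by the formulas [phi].  The parameters [c] of the curve
    are quantified, so that for fixed [phi] this is first-order; it would not
    be if [phi] were quantified as well. *)
Definition compactness_instance (L : language) (T : structure L) k
    (dim : 'I_k -> nat) (D : forall i, set (vec T (dim i)))
    (R : forall i j, vec T (dim i) -> vec T (dim j) -> Prop)
    (phi : 'I_k -> formula L) : Prop :=
  forall (c : 'I_k * nat -> T) (a b : endpoint T),
    let G j (t : T) (x : vec T (dim j)) :=
      sat (env (vcat (fun _ : 'I_1 => t) x) (fun n => c (j, n))) (phi j) in
    elt a b -> curve_in_charts D R a b G ->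
    limit_in_charts D a b G (fun c => elt a (Fin c)) (fun c t => lt t c) /\
    limit_in_charts D a b G (fun c => elt (Fin c) b) (fun c t => lt c t).

(** The head connective or quantifier of an explicit property selects the
    closure lemma, so that no formula ever has to be written down. *)
Ltac first_order_step :=
  cbv beta;
  match goal with
  | |- first_order (fun _ _ => _ <-> _) => apply first_order_equiv
  | |- first_order (fun _ _ => _ /\ _) => apply first_order_and
  | |- first_order (fun _ _ => True) => apply first_order_True
  | |- first_order (fun _ _ => False) => apply first_order_False
  | |- first_order (fun _ _ => lt _ _) => apply first_order_lt
  | |- first_order (fun _ _ => @eq (vec _ _) _ _) => apply first_order_vec_eq
  | |- first_order (fun _ _ => sat (env (vcat _ _) _) _) =>
      apply first_order_sat_vcat
  | |- first_order (fun _ _ => sat (env _ _) _) => apply first_order_sat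
  | |- first_order (fun T _ => forall _ : endpoint T, _) =>
      apply first_order_forall_endpoint
  | |- first_order (fun T _ => forall _ : 'I_ _, _) =>
      apply first_order_forall_ord; intro
  | |- first_order (fun T _ => exists _ : 'I_ _, _) =>
      apply first_order_exists_ord; intro
  | |- first_order (fun T _ => forall _ : carrier T, _) =>
      apply first_order_forall
  | |- first_order (fun T _ => exists _ : carrier T, _) =>
      apply first_order_exists
  | |- first_order (fun T _ => forall _ : vec (carrier T) _, _) =>
      apply first_order_forall_fun
  | |- first_order (fun T _ => exists _ : vec (carrier T) _, _) =>
      apply first_order_exists_fun
  | |- first_order (fun T _ => forall _ : _ -> carrier T, _) =>
      apply first_order_forall_fun
  | |- first_order (fun _ _ => _ -> _) => apply first_order_imp
  end.

Ltac first_order_tac := repeat first_order_step.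

Section FirstOrderCharts.
Variables (L : language) (V : Type) (k : nat) (dim : 'I_k -> nat).
Variables (phiD : 'I_k -> formula L) (pD : 'I_k -> nat -> V).
Variables (phiR : 'I_k -> 'I_k -> formula L) (pR : 'I_k -> 'I_k -> nat -> V).

Let D (T : structure L) (e : V -> T) i : set (vec T (dim i)) :=
  fun x => sat (env x (fun n => e (pD i n))) (phiD i).
Let R (T : structure L) (e : V -> T) i j x y : Prop :=
  sat (env (@vcat T (dim i) (dim j) x y) (fun n => e (pR i j n))) (phiR i j).

Lemma first_order_gluing :
  first_order (fun T (e : V -> T) =>
    gluing_equivalence (D e) (R e) /\ gluing_open (D e) (R e)).
Proof.
rewrite /gluing_equivalence /gluing_open /D /R /inbox.
first_order_tac.
Qed.

Lemma first_order_compactness_instance (phi : 'I_k -> formula L) :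
  first_order (fun T (e : V -> T) => compactness_instance (D e) (R e) phi).
Proof.
rewrite /compactness_instance /curve_in_charts /limit_in_charts /D /R /inbox.
rewrite /elt.
first_order_tac.
Qed.

End FirstOrderCharts.

(** * Topology and curves of a space in terms of its charts *)

(** Boxes with infinite sides are then unions of boxes with finite ones, so
    that the latter suffice to describe the topology. *)
Definition unbounded (L : language) (T : structure L) : Prop :=
  (forall x : T, exists y : T, lt y x) /\ (forall x : T, exists y : T, lt x y).

Section Topology.
Variables (L : language) (T : structure L) (T_unb : unbounded T).

Lemma box_sub_inbox n (a b : 'I_n -> endpoint T) (x : vec T n) :
  box a b x -> exists lo hi, inbox lo hi x /\ inbox lo hi `<=` box a b.
Proof.
move=> bx.
have /choice[lo Hlo] i : exists l, lt l (x i) /\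
    forall y, lt l y -> elt (a i) (Fin y).
  have [m Hm] := T_unb.1 (x i).
  by case: (a i) (bx i) => [|l|] [] //=; [exists m|exists l].
have /choice[hi Hhi] i : exists l, lt (x i) l /\
    forall y, lt y l -> elt (Fin y) (b i).
  have [m Hm] := T_unb.2 (x i).
  by case: (b i) (bx i) => [|l|] [] //=; [exists l|exists m].
exists lo, hi; split=> [i|y Hy i].
  by split; [exact: (Hlo i).1|exact: (Hhi i).1].
by split; [exact: (Hlo i).2 (Hy i).1|exact: (Hhi i).2 (Hy i).2].
Qed.

Lemma vopen_inbox n (lo hi : vec T n) : vopen (inbox lo hi).
Proof.
by move=> x Hx; exists (fun i => Fin (lo i)), (fun i => Fin (hi i)); split.
Qed.

Lemma open_inP n (D W : set (vec T n)) : W `<=` D ->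
  open_in D W <-> forall x, W x -> exists lo hi, inbox lo hi x /\
    forall x', D x' -> inbox lo hi x' -> W x'.
Proof.
move=> WD; split=> [[U [Uo ->]] x [Dx Ux]|H].
  have [a [b [bx sub]]] := Uo _ Ux.
  have [lo [hi [Hx sub']]] := box_sub_inbox bx.
  by exists lo, hi; split=> // x' Dx' Hx'; split=> //; apply/sub/sub'.
exists [set x | exists lo hi, inbox lo hi x /\
    forall x', D x' -> inbox lo hi x' -> W x']; split.
  move=> x [lo [hi [Hx sub]]].
  exists (fun i => Fin (lo i)), (fun i => Fin (hi i)).
  by split=> // y Hy; exists lo, hi.
apply/seteqP; split=> x => [Wx|[Dx [lo [hi [Hx sub]]]]].
  by split; [exact: WD|exact: H].
exact: sub.
Qed.

Variable Y : space T.

Let D i := chart_image i (@dom L T Y i).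
Let R := @transition L T Y.

Lemma chart_image_sub i (A : set Y) : chart_image i (dom i `&` A) `<=` @D i.
Proof. by move=> x [u [[? ?] ?]]; exists u. Qed.

Definition chart_nbhd i (lo hi : vec T (dim i)) : set Y :=
  [set q | exists u : {q | dom i q}, proj1_sig u = q /\ inbox lo hi (chart u)].

(** This is where [gluing_open] enters: seen from any other chart, the points
    that chart [i] puts in a given box still form a relatively open set. *)
Lemma sopen_chart_nbhd i (lo hi : vec T (dim i)) :
  gluing_open (@D) (@R) -> sopen (chart_nbhd lo hi).
Proof.
move=> Yo j; apply/open_inP; first exact: chart_image_sub.
move=> _ [u [[_ [v [uv Hv]]] <-]].
have Ruv : R (chart u) (chart v) by exists u, v.
have [lo' [hi' [Hx' H]]] := Yo _ _ _ _ Ruv _ _ Hv.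
exists lo', hi'; split=> // x' Dx' /(H _ Dx')[y' [Hy' [u' [v' [E <- yE]]]]].
exists u'; split=> //; split; first exact: (proj2_sig u').
by exists v'; rewrite yE.
Qed.

Hypothesis Y_cover : forall p : Y, exists i, dom i p.
Hypothesis Y_inj : forall i : 'I_(nchart Y), injective (@chart L T Y i).
Hypothesis Y_open : gluing_open (@D) (@R).

Lemma sopen_contains_box (A : set Y) i (u : {p | dom i p}) :
  sopen A -> A (proj1_sig u) -> exists lo hi, inbox lo hi (chart u) /\
    forall v : {p | dom i p}, inbox lo hi (chart v) -> A (proj1_sig v).
Proof.
move=> /(_ i)/open_inP-/(_ (@chart_image_sub _ _)) H Au.
have [] := H (chart u).
  by exists u; split=> //; split=> //; exact: (proj2_sig u).
move=> lo [hi [Hu sub]]; exists lo, hi; split=> // v Hv.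
have [|w [[_ Aw] /Y_inj <- //]] := sub _ _ Hv.
by exists v; split=> //; exact: (proj2_sig v).
Qed.

Lemma sopen_intervalP a b (A : set {t : T | interval a b t}) :
  sopen (X := interval_space a b) A <-> forall t, A t -> exists c d,
    (lt c (proj1_sig t) /\ lt (proj1_sig t) d) /\
    forall s, lt c (proj1_sig s) -> lt (proj1_sig s) d -> A s.
Proof.
pose cst (x : T) : vec T 1 := fun=> x.
split=> [/(_ ord0) Ao t At|H i].
  have [||lo [hi [Hx sub]]] := (open_inP _).1 Ao (cst (proj1_sig t)).
  - by move=> x [u [_ E]]; exists u.
  - by exists (exist _ t I); do !split.
  exists (lo ord0), (hi ord0); split; first exact: (Hx ord0).
  move=> s ls sh.
  have [||u [[_ Au] /(congr1 (fun x => x ord0)) /= E]] :=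
    sub (cst (proj1_sig s)).
  - by exists (exist _ s I); do !split.
  - by move=> j; rewrite (ord1 j).
  rewrite (_ : s = proj1_sig u) //.
  by apply: eq_sig_hprop => /= *; [exact: Prop_irrelevance|].
apply/open_inP; first by move=> x [u [_ E]]; exists u.
move=> _ [u [[_ Au] <-]]; have [c [d [cd sub]]] := H _ Au.
exists (cst c), (cst d); split=> // _ [v [_ <-]] Hv; exists v; split=> //.
by split=> //; apply: sub; [exact: (Hv ord0).1|exact: (Hv ord0).2].
Qed.

Variables (a b : endpoint T) (alpha : interval_space a b -> Y).
Variable G : forall j, T -> vec T (@dim L T Y j) -> Prop.

Definition charts_of_curve : Prop := forall j t x, @G j t x <->
  exists (it : interval a b t) (v : {q | dom j q}),
    alpha (exist _ t it) = proj1_sig v /\ chart v = x.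

Hypothesis alphaG : charts_of_curve.

Lemma charts_of_curve_at t (it : interval a b t) j (v : {q | dom j q}) :
  G t (chart v) <-> alpha (exist _ t it) = proj1_sig v.
Proof.
rewrite alphaG; split=> [[it' [v' [E /Y_inj <-]]]|E]; last by exists it, v.
by rewrite -E (Prop_irrelevance it it').
Qed.

Lemma scontinuous_in_charts : scontinuous alpha <->
  forall j t x, @G j t x -> forall lo hi, inbox lo hi x ->
    exists c d, (lt c t /\ lt t d) /\ forall s,
      elt a (Fin s) -> elt (Fin s) b -> lt c s -> lt s d ->
      exists x', inbox lo hi x' /\ @G j s x'.
Proof.
split=> [cont j t x /alphaG[it [v [av <-]]] lo hi Hx|H A Ao].
  have /sopen_intervalP := cont _ (sopen_chart_nbhd lo hi Y_open).
  case/(_ (exist _ t it)); first by exists v.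
  move=> c [d [/= cd sub]]; exists c, d; split=> // s as_ sb cs sd.
  have is_ : interval a b s by split.
  have [u [au Hu]] := sub (exist _ s is_) cs sd.
  by exists (chart u); split=> //; apply/(charts_of_curve_at is_).
apply/sopen_intervalP => -[t it] At.
have [j domj] := Y_cover (alpha (exist _ t it)).
pose v := exist _ _ domj.
have [lo [hi [Hv sub]]] := sopen_contains_box (u := v) Ao At.
have Gv : G t (chart v) by apply/(charts_of_curve_at it).
have [c [d [cd K]]] := H _ _ _ Gv _ _ Hv.
exists c, d; split=> // -[s is_] /= cs sd.
have [x' [Hx' /alphaG[is' [u [au uE]]]]] := K _ is_.1 is_.2 cs sd.
rewrite /preimage /= (Prop_irrelevance is_ is') au; apply: sub.
by rewrite uE.
Qed.

Lemma limit_chartsP (cut : T -> Prop) (tail : T -> T -> Prop) :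
  (exists p : Y, forall A : set Y, sopen A -> A p ->
     exists c, cut c /\ forall t : interval_space a b,
       tail c (proj1_sig t) -> A (alpha t)) <->
  limit_in_charts (@D) a b (@G) cut tail.
Proof.
split=> [[p lim]|[i [_ [[u [_ <-]] H]]]].
  have [i domi] := Y_cover p; pose u := exist _ _ domi.
  exists i, (chart u); split; first by exists u.
  move=> lo hi Hu.
  have [|c [cutc sub]] := lim _ (sopen_chart_nbhd lo hi Y_open).
    by exists u.
  exists c; split=> // t at_ tb tc; have it : interval a b t by split.
  have [v [av Hv]] := sub (exist _ t it) tc.
  by exists (chart v); split=> //; apply/(charts_of_curve_at it).
exists (proj1_sig u) => A Ao Au.
have [lo [hi [Hu sub]]] := sopen_contains_box Ao Au.
have [c [cutc K]] := H _ _ Hu.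
exists c; split=> // -[t it] tc.
have [x' [Hx' /alphaG[it' [v [av vE]]]]] := K _ it.1 it.2 tc.
by rewrite (Prop_irrelevance it it') av; apply: sub; rewrite vE.
Qed.

Lemma curve_chartsP :
  scontinuous alpha <-> curve_in_charts (@D) (@R) a b (@G).
Proof.
rewrite scontinuous_in_charts; split=> [cont|[_ [_ [_ //]]]].
split.
  move=> j t x /alphaG[it [v [_ <-]]]; split=> //.
  by exists v; split=> //; exact: (proj2_sig v).
split.
  move=> t at_ tb; have it : interval a b t by split.
  have [j domj] := Y_cover (alpha (exist _ t it)).
  by exists j, (chart (exist _ _ domj)); apply/(charts_of_curve_at it).
split=> // j l t x y /alphaG[it [u [au <-]]]; split.
  move=> /alphaG[it' [v [av <-]]]; exists u, v.
  by rewrite -au -av (Prop_irrelevance it it').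
move=> [u' [v [uv /Y_inj uE <-]]]; apply/(charts_of_curve_at it).
by rewrite au -uE.
Qed.

End Topology.

(** * Definable compactness as a scheme of first-order conditions *)

Section Compactness.
Variables (L : language) (T : structure L) (T_unb : unbounded T) (Y : space T).

Let D i := chart_image i (@dom L T Y i).
Let R := @transition L T Y.

Hypothesis Y_cover : forall p : Y, exists i, dom i p.
Hypothesis Y_inj : forall i : 'I_(nchart Y), injective (@chart L T Y i).
Hypothesis Y_open : gluing_open (@D) (@R).

Lemma joint_vcat m n (Q : vec T m -> vec T n -> Prop) x y :
  joint Q (vcat x y) <-> Q x y.
Proof.
rewrite /joint /= /vcat.
under eq_fun do rewrite (unsplitK (inl _)).
by under [X in Q _ X]eq_fun do rewrite (unsplitK (inr _)).
Qed.

Lemma vcat_split m n (z : vec T (m + n)) :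
  vcat (fun i => z (lshift n i)) (fun i => z (rshift m i)) = z.
Proof. by apply: funext => k; rewrite /vcat; case: split_ordP => j ->. Qed.

(** The values of a curve are recovered from its charts by gluing, and its
    chart domains, being projections of the chart graphs, are definable. *)
Lemma curve_of_charts (phi : 'I_(nchart Y) -> formula L) c a b :
  let G j t (x : vec T (@dim L T Y j)) := sat (env (vcat (fun _ : 'I_1 => t) x)
     (fun n => c (j, n))) (phi j) in
  curve_in_charts (@D) (@R) a b G ->
  exists alpha : interval_space a b -> Y,
    definable_map alpha /\ charts_of_curve alpha G.
Proof.
move=> G [Gsub [Gcover [Gglue _]]].
have /choice[alpha Halpha] (t : {t : T | interval a b t}) : exists p : Y,
    exists j (u : {q | dom j q}),
      proj1_sig u = p /\ G j (proj1_sig t) (chart u).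
  case: t => t [at_ tb] /=; have [j [x Gx]] := Gcover _ at_ tb.
  have [_ [u [_ uE]]] := Gsub _ _ _ Gx.
  by exists (proj1_sig u), j, u; rewrite uE.
have alphaG : charts_of_curve (alpha : interval_space a b -> Y) G.
  move=> l t y; split=> [Gy|[it [v [av <-]]]].
    have [it _] := Gsub _ _ _ Gy; exists it.
    have [j [u [<- Gu]]] := Halpha (exist _ t it).
    have [u' [v [uv /Y_inj uE vE]]] := (Gglue _ _ _ _ _ Gu).1 Gy.
    by exists v; rewrite -uv uE.
  have [j [u [uE Gu]]] := Halpha (exist _ t it).
  by apply/(Gglue _ _ _ _ _ Gu); exists u, v; rewrite uE av.
exists alpha; split=> // i j; split.
  pose P (U : structure L) (e : nat + 'I_1 -> U) := exists x : vec U (dim j),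
    sat (env (vcat (fun _ : 'I_1 => e (inr ord0)) x) (fun n => e (inl n)))
      (phi j).
  have P_fo : first_order P by rewrite /P; first_order_tac.
  have := first_order_definable (fun n => c (j, n)) P_fo.
  suff -> : chart_image i (dom i `&` alpha @^-1` dom j) =
      [set x | P T (fun v => match v with
        inl k => c (j, k) | inr i => x i end)] by [].
  apply/seteqP; split=> x.
    move=> [[[t it] iu] [[_ /= aj] <-]].
    exists (chart (exist _ _ aj)) => /=.
    by apply/alphaG; exists it, (exist _ _ aj).
  move=> [y /alphaG[it [v [av vE]]]].
  exists (exist _ (exist _ _ it) I); split; last first.
    by apply: funext => k; rewrite (ord1 k).
  by split=> //=; rewrite /preimage /= av; exact: (proj2_sig v).
exists (phi j), (fun n => c (j, n)) => z.
rewrite -{2}(vcat_split z).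
rewrite (_ : (fun k => z (lshift (dim j) k)) = fun=> z (lshift (dim j) ord0)).
  apply: iff_trans (iff_sym (alphaG _ _ _)).
  split=> [[[[t it] iu] [v [/= av tE vE]]]|[it [v [av vE]]]].
    have {}tE := congr1 (fun x => x ord0) tE; rewrite /= in tE.
    by subst t; exists it, v.
  exists (exist _ (exist _ _ it) I), v; split=> //.
  by apply: funext => k; rewrite (ord1 k).
by apply: funext => k; rewrite (ord1 k).
Qed.

(** Both sides quantify over the same curves: a definable curve comes with
    formulas and parameters for its chart graphs, and conversely such graphs
    determine a definable curve. *)
Lemma definably_compactP : definably_compact Y <->
  forall phi, compactness_instance (@D) (@R) phi.
Proof.
split=> [Yc phi c a b G ltab HG|H a b alpha ltab alpha_def alpha_cont].
  have [alpha [alpha_def alphaG]] := curve_of_charts HG.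
  have [l r] := Yc a b alpha ltab alpha_def
    ((curve_chartsP T_unb Y_cover Y_inj Y_open alphaG).2 HG).
  have lim := limit_chartsP T_unb Y_cover Y_inj Y_open alphaG.
  split; first exact: (lim (fun c => elt a (Fin c)) (fun c t => lt t c)).1 l.
  exact: (lim (fun c => elt (Fin c) b) (fun c t => lt c t)).1 r.
have /choice[phi /choice[p Hp]] j := (alpha_def ord0 j).2.
pose G j t (x : vec T (@dim L T Y j)) :=
  sat (env (vcat (fun _ : 'I_1 => t) x) (fun n => p j n)) (phi j).
have alphaG : charts_of_curve alpha G.
  move=> j t x; apply: iff_trans (iff_sym (Hp j _)) _.
  apply: iff_trans (joint_vcat _ _ _) _.
  split=> [[[[s is_] iu] [v [/= av tE vE]]]|[it [v [av vE]]]].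
    have {}tE := congr1 (fun x => x ord0) tE; rewrite /= in tE.
    by subst s; exists is_, v.
  by exists (exist _ (exist _ _ it) I), v; split.
have HG := (curve_chartsP T_unb Y_cover Y_inj Y_open alphaG).1 alpha_cont.
have [l r] := H phi (fun z => p z.1 z.2) a b ltab HG.
have lim := limit_chartsP T_unb Y_cover Y_inj Y_open alphaG.
split; first exact: (lim (fun c => elt a (Fin c)) (fun c t => lt t c)).2 l.
exact: (lim (fun c => elt (Fin c) b) (fun c t => lt c t)).2 r.
Qed.

End Compactness.

(** * The gluing data of a definable space and of its extension *)

Section DefinableSpace.
Variables (L : language) (M : structure L) (X : space M).

Let D i := chart_image i (@dom L M X i).
Let R := @transition L M X.

Lemma definable_space_gluing_equivalence :
  definable_space X -> gluing_equivalence (@D) (@R).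
Proof.
move=> X_def; have inj := ds_inj X_def.
split; first by move=> i j x y [u [v [_ <- <-]]]; split;
  [exists u|exists v]; split=> //; exact: proj2_sig.
split; first by move=> i x [u [_ <-]]; exists u, u.
split.
  move=> i x y [u [v [uv <- <-]]]; congr chart.
  by apply: eq_sig_hprop uv => p q r; exact: Prop_irrelevance.
split; first by move=> i j x y [u [v [uv <- <-]]]; exists v, u.
move=> i j l x y z [u [v [uv <- <-]]] [v' [w [vw /inj vE <-]]].
by exists u, w; split=> //; rewrite uv -vE.
Qed.

Lemma vopenI n (U W : set (vec M n)) : o_minimal M ->
  vopen U -> vopen W -> vopen (U `&` W).
Proof.
move=> M_omin Uo Wo x [Ux Wx].
have unb : unbounded M := conj (omin_nomin M_omin) (omin_nomax M_omin).
have [a1 [b1 [H1 sub1]]] := Uo _ Ux; have [a2 [b2 [H2 sub2]]] := Wo _ Wx.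
have [lo1 [hi1 [in1 s1]]] := box_sub_inbox unb H1.
have [lo2 [hi2 [in2 s2]]] := box_sub_inbox unb H2.
have tr := omin_trans M_omin.
have /choice[lo Hlo] i : exists l, lt l (x i) /\
    forall y, lt l y -> lt (lo1 i) y /\ lt (lo2 i) y.
  have [[l1 _] [l2 _]] := (in1 i, in2 i).
  case: (omin_total M_omin (lo1 i) (lo2 i)) => l12.
  - by exists (lo2 i); split=> // y ?; split=> //; exact: tr l12 _.
  - by exists (lo2 i); rewrite l12.
  - by exists (lo1 i); split=> // y ?; split=> //; exact: tr l12 _.
have /choice[hi Hhi] i : exists l, lt (x i) l /\
    forall y, lt y l -> lt y (hi1 i) /\ lt y (hi2 i).
  have [[_ l1] [_ l2]] := (in1 i, in2 i).
  case: (omin_total M_omin (hi1 i) (hi2 i)) => l12.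
  - by exists (hi1 i); split=> // y ?; split=> //; apply: tr l12.
  - by exists (hi2 i); rewrite l12.
  - by exists (hi2 i); split=> // y ?; split=> //; apply: tr l12.
have Hx : inbox lo hi x by move=> i; split; [exact: (Hlo i).1|exact: (Hhi i).1].
have [a [b [bx sub]]] := vopen_inbox Hx.
exists a, b; split=> // y /sub Hy; split.
  apply/sub1/s1 => i; split; first exact: ((Hlo i).2 _ (Hy i).1).1.
  exact: ((Hhi i).2 _ (Hy i).2).1.
apply/sub2/s2 => i; split; first exact: ((Hlo i).2 _ (Hy i).1).2.
exact: ((Hhi i).2 _ (Hy i).2).2.
Qed.

(** Near [x], membership in the overlap comes from its openness, and landing in
    the box around [y] from continuity of the transition map. *)
Lemma definable_space_gluing_open :
  o_minimal M -> definable_space X -> gluing_open (@D) (@R).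
Proof.
move=> M_omin X_def i j x y Rxy lo hi Hy.
have unb : unbounded M := conj (omin_nomin M_omin) (omin_nomax M_omin).
have homeo := ds_trans_homeo X_def i j.
have [U [Uo UE]] := ds_overlap_open X_def i j.
have [|W [Wo WE]] := homeo_cont homeo
    (W := chart_image j (dom i `&` dom j) `&` inbox lo hi).
  by exists (inbox lo hi); split=> //; exact: vopen_inbox.
have [xi yj] := homeo_sub homeo Rxy.
have Ux : U x by move: xi; rewrite UE => -[].
have Wx : W x.
  have : [set x | exists y, (chart_image j (dom i `&` dom j) `&` inbox lo hi) y
     /\ R x y] x by exists y.
  by rewrite WE => -[].
have [a [b [bx sub]]] := vopenI M_omin Uo Wo (conj Ux Wx).
have [lo' [hi' [Hx' sub']]] := box_sub_inbox unb bx.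
exists lo', hi'; split=> // x' Dx' /sub'/sub[Ux' Wx'].
have : (chart_image i (dom i `&` dom j) `&` W) x' by split=> //; rewrite UE.
by rewrite -WE => -[y' [[_ Hy'] Rxy']]; exists y'.
Qed.

End DefinableSpace.

Section Extension.
Variables (L : language) (M S : structure L) (h : M -> S) (X : space M).

Let D i := extset h (chart_image i (@dom L M X i)).
Let R i j := extrel h (@transition L M X i j).

Hypothesis X_equiv : gluing_equivalence (@D) (@R).

(** Since being glued is an equivalence relation, a point of the extended space
    is the class of any of its representatives; the next lemmas compute the
    charts and transitions of the extended space from this. *)
Lemma glued_eqP (p q : rep S X) :
  glued h p q -> glued h p = glued h q.
Proof.
case: X_equiv => _ [_ [_ [sym trans]]] pq.
by apply/seteqP; split=> r; [apply: trans (sym _ _ _ _ pq)|exact: trans pq].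
Qed.

Lemma glue_class_refl (c : {c : set (rep S X) | glue_class h c}) (p : rep S X) :
  proj1_sig c p -> D (tagged p) /\ proj1_sig c = glued h p.
Proof.
case: c => c [q [Dq cE]] /=; rewrite cE => qp; split; last exact: glued_eqP.
by have [/(_ _ _ _ _ qp)[]] := X_equiv.
Qed.

Lemma class_of (p : rep S X) : D (tagged p) ->
  exists c : {c : set (rep S X) | glue_class h c}, proj1_sig c p.
Proof.
move=> Dp; have cp : glue_class h (glued h p) by exists p.
by exists (exist _ _ cp) => /=; case: X_equiv => _ [refl _]; apply: refl.
Qed.

Lemma class_inj (c d : {c : set (rep S X) | glue_class h c}) p :
  proj1_sig c p -> proj1_sig d p -> c = d.
Proof.
move=> /glue_class_refl[_ cE] /glue_class_refl[_ dE].
by apply: eq_sig_hprop => [? ? ?|]; [exact: Prop_irrelevance|rewrite cE dE].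
Qed.

Lemma ext_chartP i (u : {c | @ext_dom L M S h X i c}) x :
  ext_chart u = x <-> proj1_sig (proj1_sig u) (existT _ i x).
Proof.
rewrite /ext_chart; case: cid => /= y cy; split=> [<- //|cx].
have [_ cE] := glue_class_refl cy; move: cx; rewrite cE.
by case: X_equiv => _ [_ [eqP _]] /eqP.
Qed.

Lemma chart_image_ext :
  (fun i => chart_image i (@dom _ _ (ext_space h X) i)) = @D.
Proof.
apply: functional_extensionality_dep => i; apply/seteqP; split=> x.
  by move=> [u [_ /ext_chartP/glue_class_refl[]]].
move=> Dx; have [c cx] := @class_of (existT _ i x) Dx.
have ci : @ext_dom L M S h X i c by exists x.
by exists (exist _ c ci); split=> //; apply/ext_chartP.
Qed.

Lemma transition_ext : @transition _ _ (ext_space h X) = @R.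
Proof.
apply: functional_extensionality_dep => i.
apply: functional_extensionality_dep => j.
apply: funext => x; apply: funext => y; apply: propext; split.
  move=> [u [v [uv /ext_chartP cx /ext_chartP]]]; rewrite -uv.
  by have [_ ->] := glue_class_refl cx.
move=> Rxy; have Dx : D x by have [/(_ _ _ _ _ Rxy)[]] := X_equiv.
have [c cx] := @class_of (existT _ i x) Dx.
have cy : proj1_sig c (existT _ j y) by have [_ ->] := glue_class_refl cx.
have ci : @ext_dom L M S h X i c by exists x.
have cj : @ext_dom L M S h X j c by exists y.
by exists (exist _ c ci), (exist _ c cj); split=> //; apply/ext_chartP.
Qed.

Lemma ext_cover (c : ext_space h X) : exists i, dom i c.
Proof.
case: c => c cc; have [[i x] [Dx cE]] := cc; exists i, x => /=.
by rewrite cE; case: X_equiv => _ [refl _]; apply: refl.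
Qed.

Lemma ext_chart_inj i : injective (@chart _ _ (ext_space h X) i).
Proof.
move=> u v /ext_chartP cx; have /ext_chartP cy := erefl (ext_chart v).
apply: eq_sig_hprop => [? ? ?|]; first exact: Prop_irrelevance.
exact: class_inj cx cy.
Qed.

End Extension.

(** * Transfer along the elementary extension *)

(** Elementarity makes the interpretation of a definable set independent of
    the defining formula. *)
Lemma extsetP (L : language) (M S : structure L) (h : M -> S) n
    (A : set (vec M n)) phi (e : nat -> M) y :
  elementary h -> defines phi e A ->
  extset h A y <-> sat (env y (fun k => h (e k))) phi.
Proof.
move=> h_elem phiA; split=> [[psi [e' [psiA Hy]]]|Hy]; last by exists phi, e.
pose P (T : structure L) (p : nat + nat -> T) := forall x : vec T n,
  sat (env x (fun k => p (inl k))) phi <-> sat (env x (fun k => p (inr k))) psi.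
have P_fo : first_order P by rewrite /P; first_order_tac.
have /(first_order_transfer h_elem (inl 0) P_fo) : P M (fun z =>
    match z with inl k => e k | inr k => e' k end).
  by move=> x; exact: iff_trans (iff_sym (phiA x)) (psiA x).
by move=> /(_ y) ->.
Qed.

Lemma unbounded_elementary (L : language) (M S : structure L) (h : M -> S) :
  elementary h -> inhabited M -> unbounded M -> unbounded S.
Proof.
move=> h_elem [m] M_unb.
have fo : first_order (fun (T : structure L) (_ : unit -> T) => unbounded T).
  by rewrite /unbounded; first_order_tac.
exact: (first_order_transfer h_elem tt fo (fun=> m)).1 M_unb.
Qed.

Theorem corollary4p6 (L : language) (M S : structure L) (h : M -> S)
    (M_omin : o_minimal M) (h_elem : elementary h)
    (X : space M) (X_def : definable_space X) :
  definably_compact X <-> definably_compact (ext_space h X).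
Proof.
have [m0] := omin_inhabited M_omin.
have M_unb : unbounded M := conj (omin_nomin M_omin) (omin_nomax M_omin).
have S_unb := unbounded_elementary h_elem (omin_inhabited M_omin) M_unb.
have /choice[phiD /choice[eD HD]] := ds_image X_def.
have /choice[phiR HR] := fun ij : 'I_(nchart X) * 'I_(nchart X) =>
  ds_trans_def X_def ij.1 ij.2.
have {HR}/choice[eR HR] := HR.
(* All parameters defining the charts and transitions of [X] are put in one
   valuation [w]; the point [m0] makes its index type non-empty even when [X]
   has no chart. *)
pose k := nchart X.
pose V : Type := unit + ('I_k * nat + ('I_k * 'I_k) * nat).
pose w (v : V) : M := match v with
  | inl _ => m0 | inr (inl z) => eD z.1 z.2 | inr (inr z) => eR z.1 z.2 end.
pose pD i n : V := inr (inl (i, n)); pose pR i j n : V := inr (inr ((i, j), n)).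
pose D (T : structure L) (e : V -> T) i : set (vec T (@dim L M X i)) :=
  fun x => sat (env x (fun n => e (pD i n))) (phiD i).
pose R (T : structure L) (e : V -> T) i j x y :=
  sat (env (@vcat T (@dim L M X i) (@dim L M X j) x y) (fun n => e (pR i j n)))
    (phiR (i, j)).
have DM : (fun i => chart_image i (dom i)) = D M w.
  apply: functional_extensionality_dep => i; apply/seteqP.
  by split=> x; rewrite HD.
have RM : @transition L M X = R M w.
  apply: functional_extensionality_dep => i.
  apply: functional_extensionality_dep => j.
  apply: funext => x; apply: funext => y; apply: propext.
  by rewrite -joint_vcat (HR (i, j)).
pose wS v := h (w v).
have DS : (fun i => extset h (chart_image i (@dom L M X i))) = D S wS.
  apply: functional_extensionality_dep => i; apply/seteqP.
  by split=> x; rewrite (extsetP _ h_elem (HD i)).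
have RS : (fun i j => extrel h (@transition L M X i j)) = R S wS.
  apply: functional_extensionality_dep => i.
  apply: functional_extensionality_dep => j.
  apply: funext => x; apply: funext => y; apply: propext.
  by rewrite /extrel (extsetP _ h_elem (HR (i, j))).
have eqM := definable_space_gluing_equivalence X_def.
have opM := definable_space_gluing_open M_omin X_def.
pose phiR' i j := phiR (i, j); pose dimX := @dim L M X.
have gluing_tr := first_order_transfer h_elem (inl tt)
  (@first_order_gluing L V k dimX phiD pD phiR' pR) w.
have [eqS opS] : gluing_equivalence (D S wS) (R S wS) /\
    gluing_open (D S wS) (R S wS).
  apply: gluing_tr.1.
  have : gluing_equivalence (D M w) (R M w) /\ gluing_open (D M w) (R M w).
    by rewrite -DM -RM.
  by [].
rewrite -DS -RS in eqS opS.
rewrite (definably_compactP M_unb (ds_cover X_def) (ds_inj X_def) opM).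
have opE := opS; rewrite -(chart_image_ext eqS) -(transition_ext eqS) in opE.
rewrite (definably_compactP S_unb (ext_cover eqS) (ext_chart_inj eqS) opE).
rewrite (chart_image_ext eqS) (transition_ext eqS) DS RS DM RM.
have compact_tr phi := first_order_transfer h_elem (inl tt)
  (@first_order_compactness_instance L V k dimX phiD pD phiR' pR phi) w.
by split=> H phi; apply/compact_tr.
Qed.
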